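(* For $n\geq 1$, the number of permutations $\pi\in\mathcal{S}_n$ that have at most one descent and are involutions (i.e. $\pi^2$ is the identity) equals $\left\lfloor \frac{n^2}{4}\right\rfloor+1$.
   Context: $\mathcal{S}_n$ is the symmetric group on $[n]$; a permutation $\pi=\pi_1\cdots\pi_n$ (one-line notation) has a descent at $i\in[n-1]$ if $\pi_i>\pi_{i+1}$. Powers are under composition. *)

(* Defs.v *)
From mathcomp Require Import all_boot all_fingroup.

Set Implicit Arguments.
Unset Strict Implicit.
Unset Printing Implicit Defensive.

(* Positions and values are 0-based: s : 'S_n is the word s 0, ..., s (n - 1).
   The last position has no successor j, so it is never a descent. *)
Definition descents (n : nat) (s : 'S_n) : {set 'I_n} :=
  [set i : 'I_n | [exists j : 'I_n, (val j == (val i).+1) && (s j < s i)]].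

(* Main.v *)
(** With a single descent the word increases up to it and after it.  Let [a] be
    the least point moved by such an involution [f] and [k = f a].  Then
    [f k = a] is the least value taken on [[a, n)], so the descent is at
    [k - 1]; monotonicity on both runs together with [f (f x) = x] then gives
    [f (a + i) = k + i] for [i < k - a], and fixes everything beyond.  So the
    nontrivial solutions are the exchanges of two adjacent blocks of equal
    length [b >= 1] starting at [a], where [a + 2 b <= n], and
    [\sum_b (n + 1 - 2 b) = n ^ 2 %/ 4]. *)
Require Import Defs.
From mathcomp Require Import all_boot all_fingroup.
From mathcomp Require Import zify.

(** Kept on [nat] rather than ['I_n], so that case splits and linear arithmetic settle its
    properties; [b = 0] gives the identity. *)
Definition block_swap (a b x : nat) : nat :=
  if a <= x < a + b then x + b
  else if a + b <= x < a + b.*2 then x - b else x.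

Lemma block_swapK (a b : nat) : involutive (block_swap a b).
Proof. move=> x; rewrite /block_swap; repeat case: ifP; lia. Qed.

Lemma block_swap_lt (n a b x : nat) :
  a + b.*2 <= n -> x < n -> block_swap a b x < n.
Proof. rewrite /block_swap; repeat case: ifP; lia. Qed.

Lemma block_swap_descent (a b i : nat) :
  block_swap a b i.+1 < block_swap a b i -> i.+1 = a + b.
Proof. rewrite /block_swap; repeat case: ifP; lia. Qed.

Lemma increasing_run (f : nat -> nat) (l u : nat) :
    (forall i, l <= i -> i.+1 < u -> f i < f i.+1) ->
  forall x y, l <= x -> x < y -> y < u -> f x < f y.
Proof.
move=> step x y lx; elim: y => // y IHy; rewrite ltnS leq_eqVlt.
case/predU1P=> [<- | xy] yu; first exact: step.
by apply: ltn_trans (IHy xy _) (step y _ yu); lia.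
Qed.

Lemma descent_between (f : nat -> nat) (x y : nat) :
  x < y -> f y < f x -> exists2 p, x <= p < y & f p.+1 < f p.
Proof.
elim: y => // y IHy xy fyx; have [fdesc | fasc] := ltnP (f y.+1) (f y).
  by exists y => //; lia.
have [xy' | yx] := ltnP x y; last first.
  by move: fyx; rewrite (_ : x = y); lia.
by have [|p px fp] := IHy xy' _; [lia | exists p => //; lia].
Qed.

Lemma involution_one_descent (n : nat) (f : nat -> nat) :
    (forall x, x < n -> f x < n) -> (forall x, x < n -> f (f x) = x) ->
    (forall i j, i.+1 < n -> j.+1 < n ->
       f i.+1 < f i -> f j.+1 < f j -> i = j) ->
    (exists2 x, x < n & f x != x) ->
  exists a b, a + b.+1.*2 <= n /\
    (forall x, x < n -> f x = block_swap a b.+1 x).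
Proof.
move=> fn fK fdesc [x0 x0n fx0].
have ex0 : exists x, (x < n) && (f x != x) by exists x0; rewrite x0n.
case: (ex_minnP ex0) => a /andP[an fa] amin.
have fix_lt x : x < a -> f x = x.
  move=> xa; apply/eqP; apply: contraLR (xa) => fx.
  by rewrite -leqNgt; apply: amin; rewrite fx andbT; lia.
have ge_a x : a <= x -> x < n -> a <= f x.
  move=> ax xn; rewrite leqNgt; apply/negP => fxa.
  (* If [f x < a], then [f x] is fixed, so [x = f (f x) = f x < a]. *)
  by have := fix_lt _ fxa; rewrite fK //; lia.
have afa : a < f a by have := ge_a a (leqnn a) an; lia.
have kn := fn _ an; have fk := fK _ an.
have [|p /andP[ap pk] fp] := descent_between f a (f a) afa; first by rewrite fk.
have f_inj x y : x < n -> y < n -> f x = f y -> x = y.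
  by move=> xn yn fxy; rewrite -(fK x) // fxy fK.
have fstep i : i.+1 < n -> i != p -> f i < f i.+1.
  move=> i1n ip; have [//|fi|fi] := ltngtP (f i) (f i.+1).
    by have /eqP := fdesc i p i1n (leq_ltn_trans pk kn) fi fp; rewrite (negPf ip).
  by have := f_inj i i.+1 (ltnW i1n) i1n fi; lia.
have inc_l x y : x < y -> y <= p -> f x < f y.
  move=> xy yp; apply: (increasing_run f 0 p.+1) => // i _ ip.
  by apply: fstep; lia.
have inc_r x y : p < x -> x < y -> y < n -> f x < f y.
  by apply: increasing_run => i pi i1n; apply: fstep; lia.
have pE : p.+1 = f a.
  apply/eqP; rewrite eqn_leq pk leqNgt; apply/negP => lt_pk.
  (* Otherwise [p.+1] and [f a] both lie on the right run, forcing [f p.+1 < f (f a) = a]. *)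
  have := inc_r p.+1 (f a) (leqnn _) lt_pk kn; rewrite fk ltnNge ge_a //; lia.
pose b := f a - a.
have fE i : i < b -> f (a + i) = f a + i.
  elim: i => [|i IHi] ib; first by rewrite !addn0.
  have fi := IHi (ltnW ib).
  have lt1 : f (a + i) < f (a + i.+1) by apply: inc_l; lia.
  have fain : f (a + i.+1) < n by apply: fn; lia.
  have [//|gt|//] := ltngtP (f (a + i.+1)) (f a + i.+1); first by lia.
  (* If the value [f a + i.+1] were skipped, applying [f] on the right run would squeeze
     [f (f a + i.+1)] strictly between [a + i] and [a + i.+1]. *)
  have := inc_r (f a + i.+1) (f (a + i.+1)) _ gt fain.
  have := inc_r (f a + i) (f a + i.+1).
  by rewrite -fi !fK; lia.
have abn : a + b.*2 <= n.
  have bb : b.-1 < b by lia.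
  have := fn (a + b.-1); rewrite fE //; lia.
have mid x : a <= x < f a -> f x = x + b.
  by move=> xa; have := fE (x - a); rewrite subnKC; lia.
have mid' x : f a <= x < a + b.*2 -> f x = x - b.
  by move=> xa; rewrite -{1}(subnK (_ : b <= x)) -?mid ?fK; lia.
exists a, b.-1; rewrite prednK; last by lia.
split=> // x xn; rewrite /block_swap.
case: ifP => [xa|xa]; first by apply: mid; lia.
case: ifP => [xb|xb]; first by apply: mid'; lia.
have [/fix_lt //|ax] := ltnP x a.
have xab : a + b.*2 <= x by lia.
have fxn := fn _ xn; have ffx := fK _ xn; have afx := ge_a x ax xn.
(* A value in [[a, f a)] would be sent by [f] to a point below [a + b.*2], yet it is sent to [x]. So
   [x] and [f x] both lie on the right run, where an increasing involution fixes every point. *)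
have kfx : f a <= f x.
  rewrite leqNgt; apply/negP => fxa.
  by have := mid (f x); rewrite ffx; lia.
have [lt|gt|//] := ltngtP (f x) x.
  by have := inc_r (f x) x _ lt xn; lia.
by have := inc_r x (f x) _ gt fxn; lia.
Qed.

(** Falling back to the identity when the blocks do not fit makes this an involution for all [a] and
    [b], so the permutation needs no side condition. *)
Definition block_swap_ord (n a b : nat) (x : 'I_n) : 'I_n :=
  if a + b.*2 <= n then insubd x (block_swap a b x) else x.

Lemma block_swap_ordK (n a b : nat) : involutive (block_swap_ord n a b).
Proof.
move=> x; rewrite /block_swap_ord; case abn: (a + b.*2 <= n) => //.
have valE (y : 'I_n) : insubd y (block_swap a b y) = block_swap a b y :> nat.
  by rewrite val_insubd block_swap_lt.
by apply: val_inj; rewrite /= !valE block_swapK.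
Qed.

Definition block_swap_perm (n a b : nat) : 'S_n :=
  perm (can_inj (block_swap_ordK n a b)).

Lemma block_swap_permE (n a b : nat) (x : 'I_n) :
  a + b.*2 <= n -> block_swap_perm n a b x = block_swap a b x :> nat.
Proof.
by move=> abn; rewrite permE /block_swap_ord abn val_insubd block_swap_lt.
Qed.

Lemma block_swap_perm_invol (n a b : nat) : (block_swap_perm n a b ^+ 2 = 1)%g.
Proof. by apply/permP => x; rewrite expgS expg1 permM perm1 !permE block_swap_ordK. Qed.

Lemma descentsP (n : nat) (s : 'S_n) (i : 'I_n) :
  reflect (exists2 j : 'I_n, val j = i.+1 & s j < s i) (i \in descents s).
Proof.
rewrite inE; apply: (iffP existsP) => [[j /andP[/eqP ji sji]]|[j ji sji]].
  by exists j.
by exists j; rewrite ji eqxx.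
Qed.

Lemma descents_block_swap_perm (n a b : nat) :
  a + b.*2 <= n -> #|descents (block_swap_perm n a b)| <= 1.
Proof.
move=> abn; have desc (i : 'I_n) :
  i \in descents (block_swap_perm n a b) -> i.+1 = a + b.
  case/descentsP => j jE; rewrite !block_swap_permE // -[nat_of_ord j]/(val j) jE.
  exact: block_swap_descent.
apply/card_le1_eqP => i j /desc iE /desc jE.
by apply: val_inj => /=; lia.
Qed.

Lemma card_block_pairs (n : nat) :
  #|[set p : 'I_n * 'I_n | p.1 + p.2.+1.*2 <= n]| = n ^ 2 %/ 4.
Proof.
have sumE m : \sum_(i < m) (m.+1 - i.+1.*2) = m ^ 2 %/ 4.
  elim/ltn_ind: m => -[|[|m]] IHm; rewrite ?big_ord0 ?big_ord1 //.
  (* From [m] to [m.+2]: the first term is [m + 1], the last truncates to 0, and the middle ones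
     form the sum for [m]. *)
  rewrite big_ord_recl big_ord_recr /= [X in _ + (_ + X)](_ : _ = 0) ?addn0; last first.
    by rewrite /bump; lia.
  have -> : m.+2 ^ 2 = (m + 1) * 4 + m ^ 2 by lia.
  rewrite divnMDl // -IHm //; congr (_ + _); lia.
have countE m c : \sum_(i < m) (i < c) = minn m c.
  elim: m => [|m IHm]; first by rewrite big_ord0 min0n.
  by rewrite big_ord_recr /= IHm; lia.
rewrite -sumE -sum1dep_card big_mkcond /=.
rewrite -(pair_bigA _ (fun i j : 'I_n => if i + j.+1.*2 <= n then 1 else 0)) /=.
rewrite exchange_big /=; apply: eq_bigr => j _.
(* As [j.+1.*2 >= 2], the bound is below [n] and the minimum in [countE] is the bound itself. *)
transitivity (\sum_(i < n) (i < n.+1 - j.+1.*2)); last by rewrite countE; lia.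
by apply: eq_bigr => i _; case: ifP; lia.
Qed.

(** Points move forward only in the first block, and by exactly its length. Evaluating at [a] gives
    [b = b'] and [a' <= a]; evaluating at [a'] gives the converse inequality. *)
Lemma block_swap_perm_inj (n a b a' b' : nat) :
    0 < b -> 0 < b' -> a + b.*2 <= n -> a' + b'.*2 <= n ->
  block_swap_perm n a b = block_swap_perm n a' b' -> a = a' /\ b = b'.
Proof.
move=> b0 b'0 abn abn' eq_s.
have eq_f x : x < n -> block_swap a b x = block_swap a' b' x.
  by move=> xn; rewrite -!(block_swap_permE _ _ _ (Ordinal xn)) // eq_s.
have := eq_f a; have := eq_f a'; rewrite /block_swap.
by repeat case: ifP; lia.
Qed.

Lemma involution_descents_le1P (n : nat) (s : 'S_n) :
    s != 1%g -> #|descents s| <= 1 -> (s ^+ 2 = 1)%g ->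
  exists a b, a + b.+1.*2 <= n /\ s = block_swap_perm n a b.+1.
Proof.
move=> s1 s_desc s_invol.
have sK x : s (s x) = x by rewrite -permM -[(s * s)%g]/(s ^+ 2)%g s_invol perm1.
(* The values from [n] on are arbitrary: [f] is only examined below [n]. *)
pose f x := if insub x is Some i then val (s i) else x.
have fE (i : 'I_n) : f i = s i by rewrite /f valK.
have fEn x (xn : x < n) : f x = s (Ordinal xn) by rewrite -fE.
have [||i j i1n j1n fi fj||a [b [abn fab]]] := involution_one_descent n f.
- by move=> x xn; rewrite fEn.
- by move=> x xn; rewrite (fEn x xn) fE sK.
- have desc k (k1n : k.+1 < n) : f k.+1 < f k -> Ordinal (ltnW k1n) \in descents s.
    by move=> fk; apply/descentsP; exists (Ordinal k1n); rewrite // -!fE.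
  have /card_le1_eqP/(_ _ _ (desc i i1n fi) (desc j j1n fj)) := s_desc.
  by case.
- have [x sx] : exists x, s x != x.
    apply/existsP; apply: contraR s1; rewrite negb_exists => /forallP s_fix.
    by apply/eqP/permP => x; rewrite perm1; apply/eqP; have := s_fix x; rewrite negbK.
  by exists x; rewrite ?fE.
exists a, b; split=> //; apply/permP => x; apply: val_inj => /=.
by rewrite block_swap_permE // -fab ?fE.
Qed.

Theorem theorem2p3 (n : nat) (hn : 1 <= n) :
  #|[set s : 'S_n | (#|descents s| <= 1) && (s ^+ 2 == 1)%g]| = n ^ 2 %/ 4 + 1.
Proof.
(* The second coordinate is the block length minus one, so [F] yields only nontrivial swaps on [P];
   the identity supplies the [+ 1]. *)
pose P := [set p : 'I_n * 'I_n | p.1 + p.2.+1.*2 <= n].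
pose F (p : 'I_n * 'I_n) := block_swap_perm n p.1 p.2.+1.
have F_inj : {in P &, injective F}.
  move=> [a b] [a' b']; rewrite !inE /= => abn abn'.
  case/block_swap_perm_inj => //= aE bE.
  by congr (_, _); apply: val_inj => /=; lia.
have descents1 : descents (1%g : 'S_n) = set0.
  by apply/setP => i; rewrite in_set0; apply/descentsP => -[j /= jE]; rewrite !perm1; lia.
rewrite -card_block_pairs -/P -(card_in_imset F_inj) addnC.
have notin1 : 1%g \notin F @: P.
  apply/imsetP => -[[a b]]; rewrite inE /F /= => abn /permP/(_ a)/(congr1 val) /=.
  by rewrite block_swap_permE // perm1 /block_swap; case: ifP; lia.
rewrite -[_ + _](_ : #|1%g |: F @: P| = _); last by rewrite cardsU1 notin1.
apply: eq_card => s; rewrite inE in_setU1; apply/andP/predU1P.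
  case=> s_desc /eqP s_invol; have [->|s1] := eqVneq s 1%g; [by left | right].
  have [a [b [abn ->]]] := involution_descents_le1P _ _ s1 s_desc s_invol.
  have an : a < n by lia.
  have bn : b < n by lia.
  by apply/imsetP; exists (Ordinal an, Ordinal bn); rewrite ?inE.
case=> [->|/imsetP[[a b]]]; first by rewrite descents1 cards0 expg1n.
rewrite inE /= => abn ->; split; first exact: descents_block_swap_perm.
by rewrite block_swap_perm_invol.
Qed.
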